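(* Let $1\le p\le2$ with Hölder conjugate $q$, $n\ge2$, $0<\epsilon<1$, $0<\delta<1/2$. Any algorithm that solves the uniformity testing problem for $\ell_p$ distance with tolerance $\epsilon$ and failure probability $\delta$ on support size $n$ must draw at least \[ m=\begin{cases}\sqrt{\ln\left(1+(1-2\delta)^2\right)}\,\dfrac{\sqrt n}{(\epsilon n^{1/q})^2} & n\le\frac1{\epsilon^q},\\[1em] \sqrt{2(1-2\delta)}\sqrt{\dfrac{1}{(2\epsilon)^q}} & n\ge\frac1{\epsilon^q}\end{cases}\] samples.
   Context: A distribution on support size $n$ is a vector $A\in\mathbb{R}^n$, $A_i\ge0$, $\sum_iA_i=1$; $U_n$ is uniform on $\{1,\dots,n\}$; $\|V\|_p=(\sum_i|V_i|^p)^{1/p}$. Uniformity testing: given $p,n,\epsilon,\delta$ and access to i.i.d. samples from an unknown distribution $A$ on $\{1,\dots,n\}$, the algorithm chooses a number $m$ of samples, draws them, and must output ``uniform'' with probability at least $1-\delta$ if $A=U_n$, and ``not uniform'' with probability at least $1-\delta$ if $\|A-U_n\|_p\ge\epsilon$. Hölder conjugate: $q=p/(p-1)$ for $1<p\le 2$, $q=\infty$ for $p=1$; when $q=\infty$, $n^{1/q}=1$ and $n\le1/\epsilon^q$ holds for all $n$.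
   Formalization: In the case n ≥ 1/ε^q, an algorithm that draws no samples is covered only if some distribution A has ‖A−U_n‖_p ≥ ε; otherwise (e.g. p=2, n=2, ε=0.9) always answering ''uniform'' without sampling is correct and the positive bound fails. *)

(* Defs.v *)
From HB Require Import structures.
From mathcomp Require Import all_boot all_order all_algebra.
From mathcomp Require Import all_classical all_reals all_analysis.

Set Implicit Arguments.
Unset Strict Implicit.
Unset Printing Implicit Defensive.

Import Order.TTheory GRing.Theory Num.Theory.

Local Open Scope ring_scope.

Definition is_distribution (R : realType) (n : nat) (A : 'rV[R]_n) : Prop :=
  (forall i, 0 <= A 0 i) /\ \sum_(i < n) A 0 i = 1.

Definition uniform_vec (R : realType) (n : nat) : 'rV[R]_n :=
  \row_(i < n) (n%:R)^-1.

Definition lp_norm (R : realType) (n : nat) (p : R) (V : 'rV[R]_n) : R :=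
  (\sum_(i < n) `|V 0 i| `^ p) `^ p^-1.

(* Probability of seeing s as m independent samples from A. *)
Definition sample_prob (R : realType) (n m : nat) (A : 'rV[R]_n)
    (s : m.-tuple 'I_n) : R :=
  \prod_(j < m) A 0 (tnth s j).

(* A possibly randomized algorithm drawing m samples is represented by the
   conditional probability T s that it outputs "uniform" on seeing s; it
   outputs "not uniform" with the complementary probability.  Deterministic
   algorithms are those with T s = 0 or 1. *)
Definition is_tester (R : realType) (n m : nat) (T : m.-tuple 'I_n -> R) :
    Prop :=
  forall s, 0 <= T s <= 1.

Definition prob_uniform (R : realType) (n m : nat) (T : m.-tuple 'I_n -> R)
    (A : 'rV[R]_n) : R :=
  \sum_(s : m.-tuple 'I_n) sample_prob A s * T s.

Definition prob_not_uniform (R : realType) (n m : nat)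
    (T : m.-tuple 'I_n -> R) (A : 'rV[R]_n) : R :=
  \sum_(s : m.-tuple 'I_n) sample_prob A s * (1 - T s).

Definition lp_far_from_uniform (R : realType) (n : nat) (p eps : R)
    (A : 'rV[R]_n) : Prop :=
  is_distribution A /\ eps <= lp_norm p (A - uniform_vec R n).

Definition solves_uniformity_testing (R : realType) (n m : nat)
    (p eps delta : R) (T : m.-tuple 'I_n -> R) : Prop :=
  [/\ is_tester T,
      1 - delta <= prob_uniform T (uniform_vec R n) &
      forall A : 'rV[R]_n, lp_far_from_uniform p eps A ->
        1 - delta <= prob_not_uniform T A].

(* n ^ (1/q); since 1/+oo = 0 in \bar R, this is 1 when q = +oo. *)
Definition root_conj (R : realType) (n : nat) (q : \bar R) : R :=
  n%:R `^ fine (q^-1)%E.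

(* 1 / eps ^ q for 0 < eps < 1, with value +oo when q = +oo; the case
   q = -oo does not occur for a Hoelder conjugate of p >= 1. *)
Definition inv_pow_conj (R : realType) (eps : R) (q : \bar R) : \bar R :=
  match q with
  | r%:E%E => ((eps `^ r)^-1)%:E
  | _ => +oo%E
  end.

Definition small_support_bound (R : realType) (n : nat) (eps delta : R)
    (q : \bar R) : R :=
  Num.sqrt (ln (1 + (1 - 2 * delta) ^+ 2)) *
    (Num.sqrt n%:R / (eps * root_conj n q) ^+ 2).

(* Only meaningful for finite q, where fine q = q. *)
Definition large_support_bound (R : realType) (eps delta : R) (q : \bar R) :
    R :=
  Num.sqrt (2 * (1 - 2 * delta)) * Num.sqrt (((2 * eps) `^ fine q)^-1).

(* Main.v *)
(* Both bounds play the uniform distribution against a mixture, over a finite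
   family of far distributions A_i, of the laws of the m samples.

   For n <= 1 / eps^q, Cauchy-Schwarz bounds 4 (1 - 2 delta)^2 by the chi-square
   divergence of the mixture, which is the average over i, j of
   (n <A_i, A_j>)^m, minus 1.  Take A_i = (1 + b V_i) / n, where V_i puts an
   independent random +1/-1 on each of n / 2 pairs of coordinates.  When n is
   odd, three coordinates get a random permutation of (2, -1, -1) instead; this
   increases the distance to uniform, so that a smaller b suffices, and the
   slack between 4 and 1 in front of (1 - 2 delta)^2 absorbs the worse moment
   generating function of the triple.

   For n >= 1 / eps^q, the A_i are the uniform distributions on the k-element
   subsets, with k the integer part of X = 1 / (2 eps)^q.  Each sequence of
   distinct samples is at most as likely under the mixture as under the uniform
   distribution, so only collisions help: 1 - 2 delta <= m (m - 1) / (2 k).  If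
   X < 1, use point masses (k = 1) when they are far from uniform; otherwise
   eps^p > 1/2, hence X <= 1/2 and the bound is at most 1. *)

Require Import Defs.
From HB Require Import structures.
From mathcomp Require Import all_boot all_order all_algebra.
From mathcomp Require Import all_classical all_reals all_analysis.
From mathcomp Require Import ring lra zify.

Set Implicit Arguments.
Unset Strict Implicit.
Unset Printing Implicit Defensive.

Import Order.TTheory GRing.Theory Num.Theory.
Import numFieldNormedType.Exports.

Local Open Scope ring_scope.

(** * Moment generating functions of two-point laws *)

Lemma ge0_is_derive_ndecr (R : realType) (f df : R -> R) :
  (forall x : R, is_derive x (1 : R) f (df x)) -> (forall x, 0 <= x -> 0 <= df x) ->
  forall x, 0 <= x -> f 0 <= f x.
Proof.
move=> fdf df0 x x0.
apply: (@ger0_derive1_ndecry _ f 0) => //.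
- move=> y; rewrite in_itv/= andbT => y0.
  by rewrite derive1E (@derive_val _ _ _ _ _ _ _ (fdf y)) df0// ltW.
- apply: continuous_subspaceT => y.
  by apply/differentiable_continuous/derivable1_diffP; case: (fdf y).
Qed.

(** The difference of the two sides vanishes at [v = 0]; its derivative has the sign of
    [c * (1 + v + r * expR (- v)) - 1], and [r * expR (- v) >= 1 + ln r - v]. *)
Lemma expR_sub1_le (R : realType) (r c v : R) :
  0 < r -> 0 <= c -> 1 <= c * (2 + ln r) -> 0 <= v ->
  expR v - 1 <= c * v * (expR v + r).
Proof.
move=> r0 c0 hc v0; rewrite -subr_ge0.
pose f (x : R) := c * x * (expR x + r) - (expR x - 1).
have -> : 0 = f 0 by rewrite /f expR0; ring.
rewrite -/(f v).
pose df (x : R) := expR x * (c * (1 + x + r * expR (- x)) - 1).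
apply: (@ge0_is_derive_ndecr _ f df) => // x.
- rewrite /f /df; apply: is_derive_eq; rewrite /GRing.scale/=.
  have : expR x * expR (- x) = 1 by exact: expRxMexpNx_1.
  move=> h; transitivity (c * (expR x + r * (expR x * expR (- x))) + c * x * expR x - expR x); last by ring.
  by rewrite h; ring.
- move=> x0; apply: mulr_ge0; first exact: expR_ge0.
  rewrite subr_ge0; apply: (le_trans hc); apply: ler_wpM2l => //.
  have : 1 + (ln r - x) <= r * expR (- x).
    by rewrite -{2}(@lnK _ r) ?posrE// -expRD expR_ge1Dx.
  lra.
Qed.

(* The centred law with values r and -1 of weights 1/(r+1) and r/(r+1); the
   bound says that its product with exp (- c u^2) decreases in u >= 0. *)
Lemma two_point_mgf (R : realType) (r c u : R) :
  0 < r -> 0 <= c -> r * (r + 1) <= 2 * c * (2 + ln r) -> 0 <= u ->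
  expR (r * u) + r * expR (- u) <= (r + 1) * expR (c * u ^+ 2).
Proof.
move=> r0 c0 hc u0.
pose f (x : R) := - ((expR (r * x) + r * expR (- x)) * expR (- (c * x ^+ 2))).
pose df (x : R) := expR (- x) * expR (- (c * x ^+ 2)) *
  (2 * c * x * (expR ((r + 1) * x) + r) - r * (expR ((r + 1) * x) - 1)).
have H : f 0 <= f u.
  apply: (@ge0_is_derive_ndecr _ f df) => // x.
  - rewrite /f /df; apply: is_derive_eq; rewrite /GRing.scale/=.
    have -> : expR (r * x) = expR (- x) * expR ((r + 1) * x).
      by rewrite -expRD; congr expR; ring.
    ring.
  - move=> x0; apply: mulr_ge0; first by rewrite mulr_ge0 ?expR_ge0.
    have rr : 0 < r * (r + 1) by rewrite mulr_gt0 ?addr_gt0.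
    rewrite subr_ge0.
    have v0 : 0 <= (r + 1) * x by rewrite mulr_ge0// addr_ge0 ?ler01 ?ltW.
    (* At [v = (r + 1) * x], the sign of [df x] is [expR_sub1_le] with this constant. *)
    have k0 : 0 <= 2 * c / (r * (r + 1)) by apply: divr_ge0; [lra|exact: ltW].
    have k1 : 1 <= 2 * c / (r * (r + 1)) * (2 + ln r).
      by rewrite mulrAC ler_pdivlMr// mul1r.
    have /(ler_wpM2l (ltW r0)) := expR_sub1_le r0 k0 k1 v0.
    suff -> : 2 * c * x * (expR ((r + 1) * x) + r) = r * (2 * c / (r * (r + 1)) *
        ((r + 1) * x) * (expR ((r + 1) * x) + r)) by [].
    by field; rewrite !gt_eqF ?addr_gt0.
move: H; rewrite /f lerN2 !mulr0 oppr0 expR0 expr0n/= mulr0 oppr0 expR0.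
by rewrite mulr1 [expR (- (c * _))]expRN ler_pdivrMr ?expR_gt0// mulr1 [1 + r]addrC.
Qed.

(** Case [r = 1], [c = 1/2], where the condition of [two_point_mgf] is an equality. *)
Lemma cosh_le (R : realType) (u : R) : 0 <= u ->
  expR u + expR (- u) <= 2 * expR (u ^+ 2 / 2).
Proof.
move=> u0; have := @two_point_mgf R 1 2^-1 u ltr01.
rewrite ln1 !mul1r [_^-1 * _]mulrC => /(_ _ _ u0) -> //; lra.
Qed.

(** Amounts to [expR (4/7) <= (7/5)^2 < 2]. The value 4/7 is what [triple_mgf] needs: for [r = 2]
    and [c = 7/6] the condition of [two_point_mgf] becomes [6 <= 6]. *)
Lemma ln2_ge (R : realType) : 4 / 7 <= ln (2 : R).
Proof.
have e27 : (5 / 7 : R) <= expR (- (2 / 7)).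
  by apply: le_trans (expR_ge1Dx _); lra.
have e47 : expR (- (4 / 7)) = expR (- (2 / 7)) ^+ 2 :> R.
  by rewrite -expRM_natl; congr expR; lra.
rewrite -ler_expR lnK ?posrE// -[leLHS]invrK -expRN e47.
rewrite -[leRHS]invrK lef_pV2 ?posrE ?exprn_gt0 ?expR_gt0 ?invr_gt0//.
apply: (@le_trans _ _ ((5 / 7) ^+ 2)); first lra.
by rewrite lerXn2r// nnegrE ?expR_ge0//; lra.
Qed.

Lemma triple_mgf (R : realType) (t : R) : 0 <= t ->
  expR (6 * t) + 2 * expR (- (3 * t)) <= 3 * expR (21 / 2 * t ^+ 2).
Proof.
move=> t0; have := @two_point_mgf R 2 (7 / 6) (3 * t).
have -> : 2 * (3 * t) = 6 * t by ring.
have -> : 7 / 6 * (3 * t) ^+ 2 = 21 / 2 * t ^+ 2 by field.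
have -> : (2 + 1 = 3 :> R) by ring.
have := @ln2_ge R => h; apply; lra.
Qed.

(** * Testing uniform against a mixture *)

Lemma sum_tuple_prod (R : realType) (I : finType) (m : nat) (F : I -> R) :
  \sum_(s : m.-tuple I) \prod_(j < m) F (tnth s j) = (\sum_i F i) ^+ m.
Proof.
rewrite -[m in RHS]card_ord -prodr_const bigA_distr_bigA.
rewrite (reindex (fun f : {ffun 'I_m -> I} => [tuple f j | j < m])) /=.
  by apply: eq_bigr => f _; apply: eq_bigr => j _; rewrite tnth_mktuple.
exists (fun s : m.-tuple I => [ffun j => tnth s j]) => [f _|s _].
- by apply/ffunP => j; rewrite ffunE tnth_mktuple.
- by apply: eq_from_tnth => j; rewrite tnth_mktuple ffunE.
Qed.

Lemma sum_sample_prob (R : realType) (n m : nat) (A : 'rV[R]_n) :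
  is_distribution A -> \sum_(s : m.-tuple 'I_n) sample_prob A s = 1.
Proof. by case=> _ A1; rewrite /sample_prob sum_tuple_prod A1 expr1n. Qed.

Lemma uniform_vec_distribution (R : realType) (n : nat) :
  (0 < n)%N -> is_distribution (uniform_vec R n).
Proof.
move=> n0; split=> [i|]; first by rewrite mxE invr_ge0.
under eq_bigr do rewrite mxE.
by rewrite sumr_const card_ord -[_ *+ n]mulr_natl divff// pnatr_eq0 -lt0n.
Qed.

Lemma sample_prob_uniform (R : realType) (n m : nat) (s : m.-tuple 'I_n) :
  sample_prob (uniform_vec R n) s = n%:R ^- m.
Proof.
rewrite /sample_prob; under eq_bigr do rewrite mxE.
by rewrite prodr_const card_ord exprVn.
Qed.

Lemma sample_prob_ge0 (R : realType) (n m : nat) (A : 'rV[R]_n)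
    (s : m.-tuple 'I_n) : is_distribution A -> 0 <= sample_prob A s.
Proof. by case=> A0 _; apply: prodr_ge0. Qed.

Definition mixture_prob (R : realType) (I : finType) (n m : nat)
    (A : I -> 'rV[R]_n) (s : m.-tuple 'I_n) : R :=
  #|I|%:R^-1 * \sum_i sample_prob (A i) s.

Section Mixture.
Context {R : realType} {I : finType} {n m : nat} {p eps delta : R}.
Context {T : m.-tuple 'I_n -> R} {A : I -> 'rV[R]_n}.
Hypotheses (I0 : (0 < #|I|)%N) (n0 : (0 < n)%N).
Hypothesis Afar : forall i, lp_far_from_uniform p eps (A i).
Hypothesis Tsolves : solves_uniformity_testing p eps delta T.

Let I0R : (#|I|%:R : R) != 0. Proof. by rewrite pnatr_eq0 -lt0n. Qed.

Lemma mixture_prob_ge0 (s : m.-tuple 'I_n) : 0 <= mixture_prob A s.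
Proof.
rewrite mulr_ge0 ?invr_ge0// sumr_ge0// => i _.
by apply: sample_prob_ge0; case: (Afar i).
Qed.

Lemma sum_mixture_prob : \sum_(s : m.-tuple 'I_n) mixture_prob A s = 1.
Proof.
rewrite /mixture_prob -big_distrr/= exchange_big/=.
under eq_bigr => i _.
  rewrite sum_sample_prob; last by case: (Afar i).
  over.
by rewrite sumr_const -[_ *+ _]mulr_natl mulr1 mulVf.
Qed.

(** Rejection has probability at most [delta] under the uniform law and at least [1 - delta] under
    each [A i], hence under their average. *)
Lemma mixture_gap :
  1 - 2 * delta <= \sum_(s : m.-tuple 'I_n)
    (mixture_prob A s - sample_prob (uniform_vec R n) s) * (1 - T s).
Proof.
have [_ TU TA] := Tsolves.
have HU : \sum_s sample_prob (uniform_vec R n) s * (1 - T s) <= delta.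
  under eq_bigr do rewrite mulrBr mulr1.
  rewrite sumrB sum_sample_prob; last exact: uniform_vec_distribution.
  by move: TU; rewrite /prob_uniform; lra.
have HA : 1 - delta <= \sum_s mixture_prob A s * (1 - T s).
  have -> : \sum_(s : m.-tuple 'I_n) mixture_prob A s * (1 - T s) =
      #|I|%:R^-1 * \sum_i prob_not_uniform T (A i).
    rewrite /prob_not_uniform exchange_big/= big_distrr/=.
    by apply: eq_bigr => s _; rewrite /mixture_prob -mulrA big_distrl.
  rewrite ler_pdivlMl ?ltr0n// mulr_natl -sumr_const.
  by apply: ler_sum => i _; apply: TA.
under eq_bigr do rewrite mulrBl.
rewrite sumrB; lra.
Qed.

(** The right side is [n^m] times the sum of [D^2], with [D] the mixture minus the uniform law. The
    factor 4 comes from centring the test: [D] sums to 0, so [1 - T] can be replaced by [1/2 - T],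
    of absolute value at most 1/2. *)
Lemma sqr_gap_le_second_moment : delta < 2^-1 ->
  4 * (1 - 2 * delta) ^+ 2 <=
    n%:R ^+ m * (\sum_(s : m.-tuple 'I_n) mixture_prob A s ^+ 2) - 1.
Proof.
move=> d2; have [T01 _ _] := Tsolves.
set x : R := 1 - 2 * delta; have x0 : 0 < x by rewrite /x; lra.
have nm0 : 0 < (n%:R : R) ^+ m by rewrite exprn_gt0// ltr0n.
set U := sample_prob (uniform_vec R n) (m := m).
pose D s := mixture_prob A s - U s.
have UE s : U s = n%:R ^- m by exact: sample_prob_uniform.
have sU : \sum_s U s = 1 by apply/sum_sample_prob/uniform_vec_distribution.
have sD : \sum_s D s = 0 by rewrite sumrB sum_mixture_prob sU subrr.
have -> : n%:R ^+ m * (\sum_(s : m.-tuple 'I_n) mixture_prob A s ^+ 2) - 1 =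
    n%:R ^+ m * \sum_s D s ^+ 2.
  have sD2 : \sum_s D s ^+ 2 = \sum_(s : m.-tuple 'I_n) mixture_prob A s ^+ 2 - n%:R ^- m.
    transitivity (\sum_(s : m.-tuple 'I_n) (mixture_prob A s ^+ 2 -
        (2 * n%:R ^- m * mixture_prob A s - n%:R ^- m * U s))).
      by apply: eq_bigr => s _; rewrite /D UE; ring.
    rewrite !sumrB -[X in _ - (X - _)]big_distrr -[X in _ - (_ - X)]big_distrr/=.
    rewrite sU sum_mixture_prob; ring.
  by rewrite sD2 mulrBr divff// gt_eqF.
set S := \sum_s D s ^+ 2.
(* AM-GM in place of Cauchy-Schwarz: D (1/2 - T) <= D^2 N / (8x) + x / (2N) *)
have : x <= n%:R ^+ m / (8 * x) * S + x / 2.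
  have {1}-> : x / 2 = \sum_s x / 2 * U s by rewrite -big_distrr/= sU mulr1.
  rewrite {1}/S big_distrr/= -big_split/=.
  apply: (le_trans mixture_gap).
  have -> : \sum_s (mixture_prob A s - U s) * (1 - T s) =
      \sum_s D s * (2^-1 - T s).
    transitivity (\sum_s (D s * (2^-1 - T s) + D s * 2^-1)).
      by apply: eq_bigr => s _; rewrite -/(U s) -/(D s); field.
    by rewrite big_split/= -[X in _ + X]big_distrl/= sD mul0r addr0.
  apply: ler_sum => s _; rewrite UE.
  have /andP[Ts0 Ts1] := T01 s.
  set N := n%:R ^+ m; set d := D s; set g := 2^-1 - T s.
  have g2 : g ^+ 2 <= 4^-1 by rewrite /g; nra.
  have -> : N / (8 * x) * d ^+ 2 + x / 2 * N^-1 =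
      d * g + ((N * d / (2 * x) - 2 * g) ^+ 2 + 4 * (4^-1 - g ^+ 2)) * (x / (2 * N)).
    by field; rewrite !gt_eqF.
  rewrite lerDl; apply: mulr_ge0.
    by apply: addr_ge0; [exact: sqr_ge0|lra].
  by rewrite divr_ge0 ?mulr_ge0 ?(ltW x0) ?(ltW nm0).
have -> : n%:R ^+ m / (8 * x) * S = n%:R ^+ m * S / (8 * x) by ring.
rewrite -lerBlDr ler_pdivlMr; last lra.
by congr (_ <= _); field.
Qed.

(** Squaring the average gives a double sum over [i], [j], in which the sum over samples factors
    over the [m] draws. *)
Lemma second_moment_mixture :
  n%:R ^+ m * (\sum_(s : m.-tuple 'I_n) mixture_prob A s ^+ 2) =
  #|I|%:R ^- 2 * \sum_i \sum_j (n%:R * \sum_(l < n) A i 0 l * A j 0 l) ^+ m.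
Proof.
have -> : \sum_(s : m.-tuple 'I_n) mixture_prob A s ^+ 2 =
    #|I|%:R ^- 2 * \sum_(s : m.-tuple 'I_n) \sum_i \sum_j
      sample_prob (A i) s * sample_prob (A j) s.
  rewrite big_distrr/=; apply: eq_bigr => s _.
  rewrite /mixture_prob exprMn exprVn; congr (_ * _).
  rewrite expr2 big_distrl/=.
  by apply: eq_bigr => i _; rewrite big_distrr.
rewrite mulrCA; congr (_ * _); rewrite exchange_big big_distrr/=.
apply: eq_bigr => i _; rewrite exchange_big big_distrr/=.
apply: eq_bigr => j _; rewrite exprMn -sum_tuple_prod; congr (_ * _).
by apply: eq_bigr => s _; rewrite /sample_prob -big_split.
Qed.

End Mixture.

(** * Perturbations of the uniform distribution *)

(* K bounds the exponential moments of <V_i, V_j> for independent uniform i, j;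
   V_i >= -1 keeps (1 + b V_i) / d nonnegative for 0 <= b <= 1. *)
Definition perturbation_family (R : realType) (p : R) (d : nat) (N K : R) :
    Prop :=
  exists (I : finType) (V : I -> 'rV[R]_d),
  [/\ (0 < #|I|)%N,
      forall i l, -1 <= V i 0 l,
      forall i, \sum_l V i 0 l = 0,
      forall i, N <= \sum_l `|V i 0 l| `^ p &
      forall t, 0 <= t -> \sum_i \sum_j expR (t * \sum_l V i 0 l * V j 0 l) <=
        #|I|%:R ^+ 2 * expR (K * t ^+ 2)].

(** [V b] is plus or minus [(1, -1)], so inner products are 2 and -2 equally often. *)
Lemma perturbation_pair (R : realType) (p : R) : perturbation_family p 2 2 2.
Proof.
pose V (b : bool) : 'rV[R]_2 := \row_l (-1) ^+ (b + l).
have VV b b' : \sum_l V b 0 l * V b' 0 l = if b == b' then 2 else - 2.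
  rewrite 2!big_ord_recl big_ord0 !mxE/= /bump/= !addn0.
  by case: b; case: b'; rewrite /= ?expr0 ?expr1 ?addn1 ?sqrrN ?expr1n; ring.
exists bool, V; split.
- by rewrite card_bool.
- by move=> b l; rewrite mxE -signr_odd; case: odd; rewrite ?expr0 ?expr1; lra.
- by case; rewrite 2!big_ord_recl big_ord0 !mxE/= ?expr0 ?expr1; ring.
- move=> b; under eq_bigr do rewrite mxE normrX normrN1 expr1n powR1.
  by rewrite sumr_const card_ord.
- move=> t t0; rewrite card_bool !big_bool/= !VV/= mulrN [t * 2]mulrC.
  have := @cosh_le R (2 * t); rewrite mulr_ge0// => /(_ isT).
  have -> : (2 * t) ^+ 2 / 2 = 2 * t ^+ 2 by field.
  lra.
Qed.

(** The permutations of [(2, -1, -1)] have inner product 6 with themselves and -3 with each other;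
    [N = 4] bounds [2^p + 2] from below. *)
Lemma perturbation_triple (R : realType) (p : R) :
  1 <= p -> perturbation_family p 3 4 (21 / 2).
Proof.
move=> p1; pose V (i : 'I_3) : 'rV[R]_3 := \row_l (if l == i then 2 else -1).
have VV i j : \sum_l V i 0 l * V j 0 l = if i == j then 6 else - 3.
  rewrite 3!big_ord_recl big_ord0 !mxE.
  by case: i j => [[|[|[|//]]] hi] [[|[|[|//]]] hj]; rewrite -!val_eqE/=; ring.
exists 'I_3, V; split.
- by rewrite card_ord.
- by move=> i l; rewrite mxE; case: ifP => _; lra.
- move=> i; rewrite (bigD1 i)//= mxE eqxx.
  rewrite (eq_bigr (fun=> -1)) => [|l /negbTE li]; last by rewrite mxE li.
  by rewrite sumr_const cardC1 card_ord/=; ring.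
- move=> i; rewrite (bigD1 i)//= mxE eqxx.
  rewrite (eq_bigr (fun=> 1)) => [|l /negbTE li]; last first.
    by rewrite mxE li normrN1 powR1.
  rewrite sumr_const cardC1 card_ord/= ger0_norm//.
  have : (2 : R) <= 2 `^ p by rewrite le1r_powR// ler1n.
  by rewrite (natrD _ 2 2) lerD2r.
- move=> t t0; under eq_bigr do under eq_bigr do rewrite VV.
  rewrite card_ord !big_ord_recl !big_ord0 -!val_eqE/=.
  have := triple_mgf t0; rewrite mulrN [t * 6]mulrC [t * 3]mulrC; lra.
Qed.

(** Choices on the two blocks are independent: inner products add, so exponential moments
    multiply. *)
Lemma perturbation_add (R : realType) (p : R) (d1 d2 : nat) (N1 N2 K1 K2 : R) :
  perturbation_family p d1 N1 K1 -> perturbation_family p d2 N2 K2 ->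
  perturbation_family p (d1 + d2) (N1 + N2) (K1 + K2).
Proof.
move=> [I1 [V1 [c1 b1 s1 n1 k1]]] [I2 [V2 [c2 b2 s2 n2 k2]]].
have split_row (F : R -> R -> R) (u u' : 'rV[R]_d1) (v v' : 'rV[R]_d2) :
    \sum_l F (row_mx u v 0 l) (row_mx u' v' 0 l) =
    \sum_l F (u 0 l) (u' 0 l) + \sum_l F (v 0 l) (v' 0 l).
  rewrite big_split_ord/=; congr (_ + _); apply: eq_bigr => l _.
  - by rewrite !row_mxEl.
  - by rewrite !row_mxEr.
exists (I1 * I2)%type, (fun i => row_mx (V1 i.1) (V2 i.2)); split.
- by rewrite card_prod muln_gt0 c1.
- by move=> i l; rewrite mxE; case: fintype.split => l'.
- move=> [i j]; rewrite (split_row (fun a _ => a) _ (V1 i) _ (V2 j))/=.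
  by rewrite s1 s2 addr0.
- move=> [i j].
  by rewrite (split_row (fun a _ => `|a| `^ p) _ (V1 i) _ (V2 j))/= lerD.
- move=> t t0.
  have -> : \sum_i \sum_j expR (t * \sum_l
        row_mx (V1 i.1) (V2 i.2) 0 l * row_mx (V1 j.1) (V2 j.2) 0 l) =
      (\sum_i \sum_j expR (t * \sum_l V1 i 0 l * V1 j 0 l)) *
      (\sum_i \sum_j expR (t * \sum_l V2 i 0 l * V2 j 0 l)).
    rewrite big_distrlr/= [RHS]pair_bigA; apply: eq_bigr => i _ /=.
    rewrite big_distrlr/= [RHS]pair_bigA; apply: eq_bigr => j _ /=.
    by rewrite (split_row *%R) mulrDr expRD.
  rewrite card_prod natrM mulrDl expRD exprMn mulrACA.
  apply: ler_pM; rewrite ?k1 ?k2// ?sumr_ge0// => i _; rewrite sumr_ge0// => j _; exact: expR_ge0.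
Qed.

(** Pairs alone give [N = K = n]; with one triple, [N = n + 1] and [K = n + 15/2]. The last
    inequality is tightest at [n = 3], where it reads [63/2 <= 32]. *)
Lemma perturbation_exists (R : realType) (p : R) (n : nat) :
  1 <= p -> (2 <= n)%N ->
  exists N K : R,
    [/\ perturbation_family p n N K, n%:R <= N & K * n%:R <= 2 * N ^+ 2].
Proof.
move=> p1 n2.
have double_add h d N K : perturbation_family p d N K ->
    perturbation_family p (h.*2 + d) (h.*2%:R + N) (h.*2%:R + K).
  move=> dNK; elim: h => [|h IH]; first by rewrite double0 !add0r.
  rewrite doubleS -addn2 [(h.*2 + 2)%N]addnC -addnA natrD -[_ + N]addrA -[_ + K]addrA.
  exact: perturbation_add (perturbation_pair p) IH.
have [no|ne] := boolP (odd n).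
- pose h := (n - 3)./2; have nE : (n = h.*2 + 3)%N by rewrite /h; lia.
  exists (h.*2%:R + 4), (h.*2%:R + 21 / 2); split.
  + by rewrite {1}nE; apply/double_add/perturbation_triple.
  + by rewrite nE natrD lerD2l ler_nat.
  + have a0 : (0 : R) <= h.*2%:R by [].
    by rewrite nE natrD; nra.
- pose h := (n - 2)./2; have nE : (n = h.*2 + 2)%N by rewrite /h; lia.
  exists (h.*2%:R + 2), (h.*2%:R + 2); split.
  + by rewrite {1}nE; apply/double_add/perturbation_pair.
  + by rewrite nE natrD.
  + have a0 : (0 : R) <= h.*2%:R by [].
    by rewrite nE natrD; nra.
Qed.

Lemma le_lp_norm (R : realType) (n : nat) (p c : R) (V : 'rV[R]_n) :
  0 < p -> 0 <= c -> c `^ p <= \sum_(i < n) `|V 0 i| `^ p -> c <= lp_norm p V.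
Proof.
move=> p0 c0 cV; rewrite /lp_norm.
rewrite -[leLHS](@powRr1 _ c)// -(@divff _ p) ?gt_eqF// powRrM.
apply: ge0_ler_powR; rewrite ?invr_ge0 ?(ltW p0) ?nnegrE ?powR_ge0//.
by rewrite sumr_ge0// => l _; rewrite powR_ge0.
Qed.

(** [g] stands for [eps * n^(1/q)], for which [eps^p <= n * (g / n)^p] is an equality. *)
Lemma perturbation_lower_bound (R : realType) (p eps delta g N K : R)
    (n m : nat) (T : m.-tuple 'I_n -> R) :
  1 <= p <= 2 -> (0 < n)%N -> 0 < eps -> 0 < delta < 2^-1 ->
  perturbation_family p n N K -> n%:R <= N -> K * n%:R <= 2 * N ^+ 2 ->
  0 < g <= 1 -> eps `^ p <= n%:R * (g / n%:R) `^ p ->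
  solves_uniformity_testing p eps delta T ->
  Num.sqrt (ln (1 + (1 - 2 * delta) ^+ 2)) * (Num.sqrt n%:R / g ^+ 2) <= m%:R.
Proof.
move=> /andP[p1 p2] n0 eps0 /andP[d0 d2].
move=> [I [V [I0 Vge Vsum Vnorm Vmgf]]] nN KN /andP[g0 g1] geps hT.
have p0 : 0 < p by lra.
have nR : 0 < n%:R :> R by rewrite ltr0n.
have N0 : 0 < N by apply: lt_le_trans nN.
(* Where [N] exceeds [n], the amplitude shrinks so that the distance bound [bp] stays the same. *)
pose b := g * (n%:R / N) `^ p^-1.
have nN0 : 0 < n%:R / N by rewrite divr_gt0.
have nN1 : n%:R / N <= 1 by rewrite ler_pdivrMr ?mul1r.
have b0 : 0 < b by rewrite mulr_gt0 ?powR_gt0.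
have b1 : b <= 1.
  rewrite mulr_ile1 ?powR_ge0 ?(ltW g0)//.
  have := @ge0_ler_powR R p^-1; rewrite invr_ge0 (ltW p0) => /(_ isT (n%:R / N) 1).
  by rewrite powR1 !nnegrE (ltW nN0) ler01; apply.
have bp : N * (b / n%:R) `^ p = n%:R * (g / n%:R) `^ p.
  have -> : b / n%:R = g / n%:R * (n%:R / N) `^ p^-1 by rewrite /b mulrAC.
  rewrite powRM ?powR_ge0 ?divr_ge0 ?(ltW g0) ?(ltW nR)//.
  rewrite -powRrM mulVf ?gt_eqF// powRr1 ?(ltW nN0)//.
  by field; rewrite gt_eqF.
(* Uses [n / N <= 1] and [2 / p >= 1]. *)
have b2 : b ^+ 2 <= g ^+ 2 * (n%:R / N).
  rewrite exprMn ler_pM2l ?exprn_gt0// -powR_mulrn ?powR_ge0// -powRrM.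
  by rewrite ge1r_powR ?nN0// mulrC ler_pdivlMr// mul1r.
pose A i : 'rV[R]_n := \row_l ((1 + b * V i 0 l) / n%:R).
have Adist i : is_distribution (A i).
  split=> [l|].
    rewrite mxE divr_ge0 ?(ltW nR)//.
    have := Vge i l; nra.
  under eq_bigr do rewrite mxE.
  rewrite -big_distrl/= big_split/= -big_distrr/= Vsum mulr0 addr0.
  by rewrite sumr_const card_ord divff ?gt_eqF.
have Afar i : lp_far_from_uniform p eps (A i).
  split=> //; apply: le_lp_norm => //; first exact: ltW.
  apply: (le_trans geps); rewrite -bp.
  have -> : \sum_l `|(A i - uniform_vec R n) 0 l| `^ p =
      (\sum_l `|V i 0 l| `^ p) * (b / n%:R) `^ p.
    rewrite big_distrl/=; apply: eq_bigr => l _; rewrite !mxE.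
    have -> : (1 + b * V i 0 l) / n%:R - n%:R^-1 = V i 0 l * (b / n%:R) by ring.
    have bn0 : 0 <= b / n%:R by rewrite divr_ge0// ltW.
    by rewrite normrM (ger0_norm bn0) [LHS]powRM.
  by rewrite ler_wpM2r ?powR_ge0.
(* Chosen so that [(1 + b^2 / n * y)^m <= expR (t * y)] for each inner product [y] of perturbations;
   the base is nonnegative, being [n] times an inner product of distributions. *)
pose t : R := m%:R * (b ^+ 2 / n%:R).
have t0 : 0 <= t by rewrite mulr_ge0// divr_ge0 ?exprn_ge0// ltW.
have := sqr_gap_le_second_moment I0 n0 Afar hT d2.
rewrite second_moment_mixture => moment.
have {moment} : 4 * (1 - 2 * delta) ^+ 2 <= expR (K * t ^+ 2) - 1.
  apply: (le_trans moment); rewrite lerD2r.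
  rewrite ler_pdivrMl ?exprn_gt0 ?ltr0n//; apply: le_trans (Vmgf _ t0).
  apply: ler_sum => i _; apply: ler_sum => j _.
  have ip : n%:R * (\sum_(l < n) A i 0 l * A j 0 l) =
      1 + b ^+ 2 / n%:R * \sum_l V i 0 l * V j 0 l.
    transitivity (n%:R^-1 * (\sum_(l < n) 1 + b * \sum_l V i 0 l + b * \sum_l V j 0 l
        + b ^+ 2 * \sum_l V i 0 l * V j 0 l)).
      rewrite !big_distrr/= -!big_split/= big_distrr/=.
      by apply: eq_bigr => l _; rewrite !mxE; field; rewrite gt_eqF.
    rewrite !Vsum sumr_const card_ord; field; by rewrite gt_eqF.
  have ip0 : 0 <= n%:R * (\sum_(l < n) A i 0 l * A j 0 l).
    rewrite mulr_ge0// sumr_ge0// => l _.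
    by case: (Adist i) => Ai _; case: (Adist j) => Aj _; rewrite mulr_ge0.
  rewrite -mulrA expRM_natl lerXn2r ?nnegrE ?expR_ge0//.
  by rewrite ip expR_ge1Dx.
move=> gap; rewrite leNgt; apply/negP => mlt.
set x := 1 - 2 * delta in gap mlt; have x0 : 0 < x by rewrite /x; lra.
have x1 : x <= 1 by rewrite /x; lra.
have x2 : 0 < x ^+ 2 by rewrite exprn_gt0.
set L := ln (1 + x ^+ 2) in mlt; have L0 : 0 <= L by rewrite ln_ge0// lerDl ltW.
have m2 : m%:R ^+ 2 * g ^+ 4 < L * n%:R.
  have : m%:R ^+ 2 < (Num.sqrt L * (Num.sqrt n%:R / g ^+ 2)) ^+ 2.
    by rewrite ltrXn2r// nnegrE mulr_ge0 ?divr_ge0 ?sqrtr_ge0 ?exprn_ge0// ltW.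
  rewrite !exprMn !sqr_sqrtr ?(ltW nR)// exprVn -exprM mulrA.
  by rewrite ltr_pdivlMr ?exprn_gt0.
(* The factor [(n / N)^2] gained in [b^4] cancels the [N^2] of [K * n <= 2 * N^2]. *)
have Kt : K * t ^+ 2 < 2 * L.
  have b4 : b ^+ 4 <= g ^+ 4 * (n%:R / N) ^+ 2.
    rewrite -[4%N]/(2 * 2)%N !exprM -exprMn lerXn2r// nnegrE.
      by rewrite exprn_ge0 ?(ltW b0).
    by rewrite mulr_ge0 ?exprn_ge0 ?(ltW g0) ?(ltW nN0).
  apply: (@le_lt_trans _ _ (2 * (m%:R ^+ 2 * g ^+ 4) / n%:R)); last first.
    rewrite ltr_pdivrMr//; lra.
  have -> : K * t ^+ 2 = K * n%:R * (m%:R ^+ 2 * b ^+ 4 / n%:R ^+ 3).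
    by rewrite /t; field; rewrite gt_eqF.
  apply: (@le_trans _ _ (2 * N ^+ 2 * (m%:R ^+ 2 * b ^+ 4 / n%:R ^+ 3))).
    apply: ler_wpM2r => //.
    apply: divr_ge0; last by rewrite exprn_ge0.
    by apply: mulr_ge0; rewrite exprn_ge0// ltW.
  have -> : 2 * (m%:R ^+ 2 * g ^+ 4) / n%:R = 2 * N ^+ 2 *
     (m%:R ^+ 2 * (g ^+ 4 * (n%:R / N) ^+ 2) / n%:R ^+ 3).
    by field; rewrite !gt_eqF.
  rewrite ler_pM2l ?mulr_gt0 ?exprn_gt0// ler_pM2r ?invr_gt0 ?exprn_gt0//.
  by rewrite ler_wpM2l ?exprn_ge0.
(* Contradiction: [(1 + x^2)^2 <= 1 + 3 * x^2] since [x <= 1], whereas [gap] requires at least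
   [1 + 4 * x^2]. *)
have : expR (K * t ^+ 2) < (1 + x ^+ 2) ^+ 2.
  rewrite -[1 + x ^+ 2]lnK ?posrE ?addr_gt0// -expRM_natl ltr_expR.
  exact: Kt.
have : x ^+ 2 <= 1 by rewrite expr_le1// ltW.
nra.
Qed.

(** * Uniform distributions on subsets *)

(** Removing [M] is injective on these sets and lands in the subsets of the complement of [M]. *)
Lemma card_supersets_le (T : finType) (M : {set T}) (k : nat) :
  (#|[set S : {set T} | M \subset S & #|S| == k]|
     <= 'C(#|T| - #|M|, k - #|M|))%N.
Proof.
have inj : {in [set S : {set T} | M \subset S & #|S| == k] &,
    injective (fun S => S :\: M)}.
  move=> S1 S2; rewrite !inE => /andP[M1 _] /andP[M2 _] e.
  by rewrite -(finset.setID S1 M) -(finset.setID S2 M) e (finset.setIidPr M1) (finset.setIidPr M2).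
rewrite -(card_in_imset inj).
have -> : (#|T| - #|M| = #|~: M|)%N by rewrite -(cardsC M) addKn.
rewrite -cards_draws subset_leq_card//.
apply/fintype.subsetP => _ /imsetP[S + ->]; rewrite !inE => /andP[MS /eqP Sk].
by rewrite finset.subDset finset.setUCr finset.subsetT cardsD (finset.setIidPr MS) Sk eqxx.
Qed.

(** The ratio of the binomials is the product over [j < m] of [(k - j) / (n - j)], each factor being
    at most [k / n]. *)
Lemma bin_sub_expn_le (m k n : nat) : (m <= k <= n)%N ->
  ('C(n - m, k - m) * n ^ m <= 'C(n, k) * k ^ m)%N.
Proof.
elim: m => [|m IH] /andP[mk kn]; first by rewrite !subn0 !expn0.
have {}IH : ('C(n - m, k - m) * n ^ m <= 'C(n, k) * k ^ m)%N.
  by apply: IH; rewrite kn andbT ltnW.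
have diag := mul_bin_diag (n - m) (k - m.+1).
have e1 : ((n - m).-1 = n - m.+1)%N by lia.
have e2 : ((k - m.+1).+1 = k - m)%N by lia.
rewrite e1 e2 in diag.
have nm0 : (0 < n - m)%N by lia.
rewrite -(leq_pmul2l nm0) !expnS.
set c := 'C(n - m.+1, _) in diag *; set c' := 'C(n - m, _) in diag IH *.
apply: (@leq_trans ((n * (k - m)) * (c' * n ^ m))).
  by rewrite mulnA diag eq_leq//; ring.
apply: (@leq_trans ((k * (n - m)) * ('C(n, k) * k ^ m))); last first.
  by rewrite eq_leq//; ring.
by apply: leq_mul => //; nia.
Qed.

(** Birthday bound: each of the [m * (m - 1) / 2] pairs among [m] uniform draws from [k] values
    collides with probability [1 / k]. *)
Lemma ffact_ge (R : realType) (k m : nat) : (0 < k)%N ->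
  k%:R ^+ m * (1 - m%:R * (m%:R - 1) / (2 * k%:R)) <= (k ^_ m)%:R :> R.
Proof.
move=> k0; have kR : 0 < k%:R :> R by rewrite ltr0n.
elim: m => [|m IH]; first by rewrite !mul0r subr0 mulr1 expr0 ffactn0.
have [mk|km] := leqP m k.
  have mkR : m%:R <= k%:R :> R by rewrite ler_nat.
  rewrite ffactnSr natrM natrB//.
  apply: le_trans (ler_wpM2r _ IH); last by rewrite subr_ge0.
  have -> : k%:R ^+ m * (1 - m%:R * (m%:R - 1) / (2 * k%:R)) * (k%:R - m%:R) =
     k%:R ^+ m.+1 * (1 - m.+1%:R * (m.+1%:R - 1) / (2 * k%:R)) +
     k%:R ^+ m * (m%:R * (m%:R * (m%:R - 1)) / (2 * k%:R)) :> R.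
    by rewrite -[m.+1%:R]natr1 exprS; field; rewrite gt_eqF.
  have mm : 0 <= m%:R * (m%:R - 1) :> R.
    by case: (m) => [|m']; rewrite ?mul0r// mulr_ge0// subr_ge0 ler1n.
  by rewrite lerDl mulr_ge0 ?exprn_ge0// divr_ge0// mulr_ge0.
(* For [k < m] the left side is already nonpositive. *)
apply: (@le_trans _ _ 0) => //; rewrite mulr_ge0_le0 ?exprn_ge0//.
rewrite subr_le0 ler_pdivlMr ?mulr_gt0// mul1r -[m.+1%:R]natr1.
have : (k%:R + 1 : R) <= m%:R by rewrite natr1 ler_nat.
have : (1 : R) <= k%:R by rewrite ler1n.
nra.
Qed.

Definition subset_vec (R : realType) (n : nat) (S : {set 'I_n}) : 'rV[R]_n :=
  \row_l ((l \in S)%:R / #|S|%:R).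

Lemma subset_vec_distribution (R : realType) (n : nat) (S : {set 'I_n}) :
  (0 < #|S|)%N -> is_distribution (subset_vec R S).
Proof.
move=> S0; split=> [l|]; first by rewrite mxE divr_ge0.
under eq_bigr do rewrite mxE.
rewrite -big_distrl/= -natr_sum -big_mkcond/= sum1_card divff//.
by rewrite pnatr_eq0 -lt0n.
Qed.

Lemma sample_prob_subset (R : realType) (n m : nat) (S : {set 'I_n})
    (s : m.-tuple 'I_n) :
  sample_prob (subset_vec R S) s = (all (mem S) s)%:R / #|S|%:R ^+ m.
Proof.
rewrite /sample_prob; under eq_bigr do rewrite mxE.
rewrite big_split/= prodr_const card_ord exprVn; congr (_ / _).
case: allP => [sS|sS].
  rewrite big1// => j _; have -> // : tnth s j \in S.
  exact/sS/mem_tnth.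
have [j jS|h] := pickP (fun j => tnth s j \notin S).
  by rewrite (bigD1 j)//= (negbTE jS) mul0r.
case: sS => x /tnthP[j ->]; exact: negbFE (h j).
Qed.

Lemma collision_prob_le (R : realType) (n m : nat) (S : {set 'I_n}) :
  (0 < #|S|)%N ->
  \sum_(s : m.-tuple 'I_n | ~~ uniq s) sample_prob (subset_vec R S) s <=
    m%:R * (m%:R - 1) / (2 * #|S|%:R).
Proof.
move=> S0; have SR : 0 < #|S|%:R :> R by rewrite ltr0n.
have := sum_sample_prob m (subset_vec_distribution R S0).
rewrite (bigID (fun s : m.-tuple 'I_n => uniq s))/=.
have -> : \sum_(s : m.-tuple 'I_n | uniq s) sample_prob (subset_vec R S) s =
    (#|S| ^_ m)%:R / #|S|%:R ^+ m.
  under eq_bigr do rewrite sample_prob_subset.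
  rewrite -big_distrl/= -natr_sum -big_mkcondr/= sum1_card; congr (_%:R / _).
  rewrite -card_uniq_tuples cardsE; apply: eq_card => s.
  by rewrite !unfold_in/= andbC.
have := ffact_ge R m S0; rewrite mulrC -ler_pdivlMr ?exprn_gt0//.
set c := \sum_(_ | _) _; set f := _ / _ ^+ m; lra.
Qed.

Lemma subset_lower_bound (R : realType) (p eps delta : R) (n m k : nat)
    (T : m.-tuple 'I_n -> R) :
  (0 < k <= n)%N ->
  (forall S : {set 'I_n}, #|S| = k ->
     lp_far_from_uniform p eps (subset_vec R S)) ->
  solves_uniformity_testing p eps delta T ->
  2 * k%:R * (1 - 2 * delta) <= m%:R * (m%:R - 1).
Proof.
move=> /andP[k0 kn] far hT; have kR : 0 < k%:R :> R by rewrite ltr0n.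
pose D := [set S : {set 'I_n} | #|S| == k].
have cardD : #|D| = 'C(n, k) by rewrite card_draws card_ord.
pose A (i : 'I_#|D|) := subset_vec R (enum_val i).
have Ak (i : 'I_#|D|) : #|enum_val i : {set 'I_n}| = k.
  by apply/eqP; have := enum_valP i; rewrite inE.
have cardI : #|'I_(#|D|)| = 'C(n, k) by rewrite card_ord.
have I0 : (0 < #|'I_(#|D|)|)%N by rewrite cardI bin_gt0.
have Afar i : lp_far_from_uniform p eps (A i) by apply: far.
have n0 : (0 < n)%N by apply: leq_trans kn.
have := mixture_gap I0 n0 Afar hT.
have [T01 _ _] := hT.
(* A [k]-subset gives [s] probability [k^-m] if it contains the [m] distinct entries, else 0; a
   fraction at most [(k / n)^m] of the [k]-subsets contains them. *)
have uniq_le (s : m.-tuple 'I_n) : uniq s ->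
    mixture_prob A s <= sample_prob (uniform_vec R n) s.
  move=> us; rewrite sample_prob_uniform /mixture_prob cardI.
  rewrite ler_pdivrMl ?ltr0n ?bin_gt0//.
  pose M := [set x in s].
  have cardM : #|M| = m by rewrite cardsE (card_uniqP us) size_tuple.
  have -> : \sum_i sample_prob (A i) s =
      #|[set S : {set 'I_n} | M \subset S & #|S| == k]|%:R / k%:R ^+ m.
    transitivity (\sum_(S in D) sample_prob (subset_vec R S) s).
      by rewrite [RHS]big_enum_val.
    rewrite -sum1_card natr_sum big_distrl/=.
    rewrite [RHS](eq_bigl (fun S => (S \in D) && all (mem S) s)); last first.
      move=> S; rewrite !inE andbC; congr (_ && _).
      by apply/fintype.subsetP/allP => sS x xs; apply: sS; move: xs; rewrite inE.
    rewrite big_mkcondr/=; apply: eq_bigr => S.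
    rewrite inE => /eqP Sk; rewrite sample_prob_subset Sk.
    by case: all; rewrite ?mul0r.
  have [mk|km] := leqP m k; last first.
    rewrite [X in X%:R]eq_card0 ?mul0r ?mulr_ge0 ?invr_ge0 ?exprn_ge0// => S.
    rewrite !inE; apply/negP => /andP[/subset_leq_card MS /eqP Sk].
    by move: MS; rewrite cardM Sk leqNgt km.
  rewrite ler_pdivrMr ?exprn_gt0// mulrAC ler_pdivlMr ?exprn_gt0 ?ltr0n//.
  rewrite -!natrX -!natrM ler_nat.
  have := @bin_sub_expn_le m k n; rewrite mk kn => /(_ isT).
  apply: leq_trans; rewrite leq_mul2r.
  by have := card_supersets_le M k; rewrite cardM card_ord => ->; rewrite orbT.
rewrite (bigID (fun s : m.-tuple 'I_n => uniq s))/= => gap.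
(* Terms with distinct samples are nonpositive; in the others, [1 - T s <= 1] and the uniform law is
   dropped. *)
have {}gap : 1 - 2 * delta <= \sum_(s : m.-tuple 'I_n | ~~ uniq s) mixture_prob A s.
  apply: (le_trans gap); rewrite -[leRHS]add0r; apply: lerD.
    apply: sumr_le0 => s us; rewrite mulr_le0_ge0 ?subr_le0 ?uniq_le//.
    by have := T01 s; lra.
  apply: ler_sum => s _; have P0 := mixture_prob_ge0 Afar s.
  have U0 := sample_prob_ge0 s (uniform_vec_distribution R n0).
  have := T01 s; nra.
move: gap; rewrite -big_distrr/= exchange_big/= => gap.
have {}gap : 1 - 2 * delta <= m%:R * (m%:R - 1) / (2 * k%:R).
  apply: (le_trans gap); rewrite ler_pdivrMl ?ltr0n//.
  set c := _ / _; rewrite mulr_natl -sumr_const.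
  apply: ler_sum => i _; rewrite /c -(Ak i); apply: collision_prob_le.
  by rewrite Ak.
by rewrite mulrC -ler_pdivlMr ?mulr_gt0.
Qed.

(** With [k] the size of [S], each point of [S] deviates by [1/k - 1/n >= 1/(2k)], so the [p]-th
    powers sum to at least [k * (2k)^-p], which the last hypothesis compares with [eps^p]. *)
Lemma subset_vec_far (R : realType) (p eps : R) (n : nat) (S : {set 'I_n}) :
  1 <= p -> 0 < eps -> (0 < #|S|)%N -> (2 * #|S| <= n)%N ->
  #|S|%:R `^ (p - 1) <= (2 * eps) `^ (- p) ->
  lp_far_from_uniform p eps (subset_vec R S).
Proof.
move=> p1 eps0 S0 Sn hS; split; first exact: subset_vec_distribution.
have p0 : 0 < p by lra.
have kR : 0 < #|S|%:R :> R by rewrite ltr0n.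
have nR : 0 < n%:R :> R by rewrite ltr0n; lia.
set k : R := #|S|%:R in hS kR.
have kn : 2 * k <= n%:R by rewrite -natrM ler_nat.
apply: le_lp_norm => //; first exact: ltW.
apply: (@le_trans _ _ (\sum_(l in S) (2 * k)^-1 `^ p)).
  rewrite sumr_const -[_ *+ _]mulr_natl -/k.
  have k2 : 0 <= 2 * k by rewrite mulr_ge0// ltW.
  rewrite -powR_inv1// -powRrM mulN1r powRM ?(ltW kR)//.
  rewrite !powRN -(mulr_powRB1 (ltW kR) p0).
  move: hS; rewrite powRN powRM ?(ltW eps0)//.
  have e0 := powR_gt0 p eps0; have kp0 := powR_gt0 (p - 1) kR.
  have t0 : 0 < 2 `^ p :> R by rewrite powR_gt0.
  set E := eps `^ p in e0 *; set W := 2 `^ p in t0 *; set Y := k `^ _ in kp0 * => h.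
  have -> : k * (W^-1 * (k * Y)^-1) = (W * Y)^-1.
    by field; rewrite !gt_eqF.
  rewrite -[leLHS]invrK lef_pV2 ?posrE ?invr_gt0 ?mulr_gt0//.
  apply: le_trans (ler_wpM2l (ltW t0) h) _.
  by rewrite invfM mulrA divff ?gt_eqF// mul1r.
rewrite [leRHS](bigID (mem S))/= -[leLHS]addr0; apply: lerD; last first.
  by rewrite sumr_ge0// => l _; rewrite powR_ge0.
apply: ler_sum => l lS; rewrite !mxE lS mul1r -/k.
have d : (2 * k)^-1 <= k^-1 - n%:R^-1.
  have : n%:R^-1 <= (2 * k)^-1 by rewrite lef_pV2 ?posrE ?mulr_gt0.
  have -> : k^-1 = 2 * (2 * k)^-1 by field; rewrite gt_eqF.
  lra.
have d0 : 0 <= (2 * k)^-1 by rewrite invr_ge0 mulr_ge0// ltW.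
apply: ge0_ler_powR; rewrite ?nnegrE ?(ltW p0)//.
by apply: le_trans d _; exact: ler_norm.
Qed.

(** Deviations are at most 1, so for [p <= 2] their [p]-th powers dominate their squares, which sum
    to [1 - 1/n >= 1/2]. *)
Lemma point_mass_far (R : realType) (p eps : R) (n : nat) (S : {set 'I_n}) :
  1 <= p <= 2 -> 0 < eps -> #|S| = 1%N -> (2 <= n)%N -> eps `^ p <= 2^-1 ->
  lp_far_from_uniform p eps (subset_vec R S).
Proof.
move=> /andP[p1 p2] eps0 S1 n2 he; have p0 : 0 < p by lra.
have nR : 2 <= n%:R :> R by rewrite ler_nat.
have n0 : 0 < n%:R :> R by lra.
have iR : n%:R^-1 <= 2^-1 :> R by rewrite lef_pV2 ?posrE.
have i0 : 0 < n%:R^-1 :> R by rewrite invr_gt0.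
split; first by apply: subset_vec_distribution; rewrite S1.
apply: le_lp_norm => //; first exact: ltW.
apply: (le_trans he).
apply: (@le_trans _ _ (\sum_l ((subset_vec R S - uniform_vec R n) 0 l) ^+ 2)).
  have -> : \sum_l ((subset_vec R S - uniform_vec R n) 0 l) ^+ 2 =
      \sum_l ((1 - 2 / n%:R) * (l \in S)%:R + n%:R ^- 2).
    apply: eq_bigr => l _; rewrite !mxE S1 divr1.
    by case: (l \in S) => /=; field; rewrite gt_eqF.
  rewrite big_split/= -big_distrr/= -natr_sum -big_mkcond/= sum1_card S1.
  rewrite sumr_const card_ord -[n%:R ^- 2 *+ n]mulr_natl.
  have -> : n%:R * n%:R ^- 2 = n%:R^-1 :> R by field; rewrite gt_eqF.
  lra.
apply: ler_sum => l _; set x := (subset_vec R S - uniform_vec R n) 0 l.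
have x1 : `|x| <= 1.
  by rewrite /x !mxE S1 divr1 ler_norml; case: (l \in S) => /=; apply/andP; split; lra.
have [->|x0] := eqVneq x 0; first by rewrite expr0n/= powR_ge0.
rewrite -real_normK ?num_real// -powR_mulrn//.
by rewrite ger_powR// x1 normr_gt0 x0.
Qed.

(** * Hölder conjugates and the two regimes of the bound *)

Lemma root_conj_hoelder (R : realType) (p : R) (n : nat) : 1 <= p ->
  root_conj n (hoelder_conjugate p%:E) = n%:R `^ (1 - p^-1).
Proof.
rewrite le_eqVlt => /predU1P[<-|p1].
  by rewrite hoelder_conjugate1 /root_conj invey/= invr1 subrr.
have p0 : p != 0 by rewrite gt_eqF//; lra.
have p10 : p - 1 != 0 by rewrite gt_eqF//; lra.
rewrite /root_conj /hoelder_conjugate/= eqe (negbTE p0) -EFinD inver (negbTE p10).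
rewrite -EFinM inver mulf_eq0 invr_eq0 (negbTE p0) (negbTE p10)/=.
by congr (_ `^ _); field; rewrite p0 p10.
Qed.

Lemma hoelder_conjugate_gt1 (R : realType) (p : R) : 1 < p ->
  hoelder_conjugate p%:E = (p * (p - 1)^-1)%:E.
Proof.
move=> p1; have p0 : p != 0 by rewrite gt_eqF//; lra.
have p10 : p - 1 != 0 by rewrite gt_eqF//; lra.
by rewrite /hoelder_conjugate/= eqe (negbTE p0) -EFinD inver (negbTE p10).
Qed.

(** Every law gives the empty sample probability 1, so the gap in [mixture_gap] is 0. *)
Lemma no_sample_not_far (R : realType) (p eps delta : R) (n : nat)
    (T : 0.-tuple 'I_n -> R) (A : 'rV[R]_n) :
  (0 < n)%N -> delta < 2^-1 -> solves_uniformity_testing p eps delta T ->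
  ~ lp_far_from_uniform p eps A.
Proof.
move=> n0 d2 hT farA.
have I0 : (0 < #|{: unit}|)%N by rewrite card_unit.
have := mixture_gap I0 n0 (fun=> farA) hT.
rewrite big1 => [|s _]; first lra.
rewrite /mixture_prob card_unit invr1 mul1r big_const card_unit/= addr0.
by rewrite /sample_prob !big_ord0 subrr mul0r.
Qed.

(** The premise on [m = 0] excludes vacuous problems: for [p = n = 2] and [eps^2 > 1/2] no
    distribution is far, and always answering uniform succeeds without samples although the bound is
    positive. *)
Theorem theorem3 (R : realType) (p : R) (n : nat) (eps delta : R)
    (hp : 1 <= p <= 2) (hn : (2 <= n)%N)
    (heps : 0 < eps < 1) (hdelta : 0 < delta < 2^-1)
    (m : nat) (T : m.-tuple 'I_n -> R)
    (hT : solves_uniformity_testing p eps delta T) :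
  let q : \bar R := hoelder_conjugate p%:E in
  ((n%:R%:E <= inv_pow_conj eps q)%E ->
     small_support_bound n eps delta q <= m%:R) /\
  ((inv_pow_conj eps q <= n%:R%:E)%E ->
     (m = 0%N -> exists A : 'rV[R]_n, lp_far_from_uniform p eps A) ->
     large_support_bound eps delta q <= m%:R).
Proof.
move=> q; have /andP[p1 p2] := hp; have /andP[e0 e1] := heps.
have /andP[d0 d2] := hdelta; have p0 : 0 < p by lra.
have n0 : (0 < n)%N by apply: leq_trans hn.
have nR : 0 < n%:R :> R by rewrite ltr0n.
split=> hnq.
  have [N [K [pert nN KN]]] := perturbation_exists p1 hn.
  rewrite /small_support_bound root_conj_hoelder//.
  apply: (@perturbation_lower_bound _ p eps delta _ N K n m T) => //.
    rewrite mulr_gt0 ?powR_gt0//=.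
    move: hnq; rewrite /q; move: p1; rewrite le_eqVlt => /predU1P[<-|pgt1].
      by rewrite invr1 subrr powRr0 mulr1 => _; exact: ltW.
    rewrite hoelder_conjugate_gt1//= lee_fin => hnq.
    have p10 : 0 < p - 1 by lra.
    set r := p * (p - 1)^-1 in hnq; have r0 : 0 < r by rewrite divr_gt0.
    (* Here [r] is [q]; this form reduces [g <= 1] to [n <= 1 / eps^q]. *)
    have -> : eps * n%:R `^ (1 - p^-1) = (eps `^ r * n%:R) `^ r^-1.
      rewrite powRM ?powR_ge0// -powRrM divff ?gt_eqF// powRr1 ?(ltW e0)//.
      by congr (_ * _ `^ _); rewrite /r; field; rewrite !gt_eqF.
    have one : 1 `^ r^-1 = 1 :> R by rewrite powR1.
    rewrite -[leRHS]one.
    apply: ge0_ler_powR.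
    - by rewrite invr_ge0 ltW.
    - by rewrite nnegrE mulr_ge0 ?powR_ge0.
    - by rewrite nnegrE.
    - by rewrite mulrC -ler_pdivlMr ?powR_gt0// mul1r.
  have -> : eps * n%:R `^ (1 - p^-1) / n%:R = eps * n%:R `^ (- p^-1).
    rewrite powRD ?(gt_eqF nR) ?implybT// powRr1 ?(ltW nR)//.
    by field; rewrite !gt_eqF.
  rewrite powRM ?powR_ge0 ?(ltW e0)// -powRrM mulNr mulVf ?gt_eqF//.
  by rewrite powR_inv1 ?(ltW nR)// mulrCA divff ?gt_eqF// mulr1.
move=> hm0.
(* For [p = 1] the assumption [hnq] would bound [+oo] by [n]. *)
have pgt1 : 1 < p.
  move: p1; rewrite le_eqVlt => /predU1P[p1|//].
  by move: hnq; rewrite /q -p1 hoelder_conjugate1.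
move: hnq; rewrite /q hoelder_conjugate_gt1// /large_support_bound/= lee_fin.
have p10 : 0 < p - 1 by lra.
set r := p * (p - 1)^-1; have r0 : 0 < r by rewrite divr_gt0.
have r1 : 1 <= r by rewrite /r ler_pdivlMr//; lra.
move=> hnq.
set X := ((2 * eps) `^ r)^-1; have X0 : 0 < X by rewrite invr_gt0 powR_gt0 ?mulr_gt0.
set x := 1 - 2 * delta; have x0 : 0 < x by rewrite /x; lra.
have x1 : x <= 1 by rewrite /x; lra.
suff m2 : 2 * x * X <= m%:R ^+ 2.
  rewrite -sqrtrM; last by rewrite mulr_ge0// ltW.
  by rewrite -[leRHS]ger0_norm// -sqrtr_sqr ler_sqrt// exprn_ge0.
have [X1|X1] := leP 1 X.
  pose k := Num.truncn X.
  have /andP[kX Xk] : (k%:R <= X < k.+1%:R) by apply: truncn_itv; exact: ltW.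
  have k0 : (0 < k)%N.
    by rewrite lt0n; apply/eqP => k0; move: Xk; rewrite k0 ltNge X1.
  (* As [q >= 1], [2^q >= 2], hence [2 * X <= 1 / eps^q <= n]. *)
  have kn : (2 * k <= n)%N.
    rewrite -(ler_nat R) natrM; apply: le_trans hnq.
    apply: (@le_trans _ _ (2 * X)); first by rewrite ler_pM2l.
    rewrite /X powRM ?(ltW e0)// invfM mulrA ler_piMl ?invr_ge0 ?powR_ge0//.
    by rewrite ler_pdivrMr ?powR_gt0// mul1r le1r_powR// ler1n.
  have := @subset_lower_bound _ p eps delta n m k T.
  rewrite k0/= => /(_ _ _ hT) h.
  have {h} : 2 * k%:R * x <= m%:R * (m%:R - 1).
    apply: h; first by apply: leq_trans kn; rewrite leq_pmull.
    move=> S Sk; apply: subset_vec_far; rewrite ?Sk//.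
    (* By [q * (p - 1) = p]; the distance condition becomes a consequence of [k <= X]. *)
    have -> : (2 * eps) `^ (- p) = X `^ (p - 1).
      rewrite /X -powRN -powRrM; congr (_ `^ _).
      by rewrite /r; field; rewrite gt_eqF.
    by apply: ge0_ler_powR; rewrite ?nnegrE ?(ltW p10) ?(ltW X0).
  have k1 : (1 : R) <= k%:R by rewrite ler1n.
  have [m1|m2] := leqP m 1.
    case: (m) m1 => [|[|//]] _; nra.
  (* Rounding [X] down to [k] costs at most [2 * x <= 2 <= m], the gap between [m * (m - 1)] and
     [m^2]. *)
  have m2R : (2 : R) <= m%:R by rewrite ler_nat.
  rewrite -[k.+1%:R]natr1 in Xk; nra.
have [he|he] := leP (eps `^ p) 2^-1.
  have := @subset_lower_bound _ p eps delta n m 1 T.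
  rewrite n0/= => /(_ isT _ hT) h.
  have {h} : 2 * 1 * x <= m%:R * (m%:R - 1).
    by apply: h => S S1; exact: point_mass_far.
  have : (0 : R) <= m%:R by [].
  nra.
(* From [(2 * eps)^p >= 2^(p - 1)], raised to the power [1 / (p - 1)]. *)
have X2 : X <= 2^-1.
  rewrite lef_pV2 ?posrE ?powR_gt0 ?mulr_gt0// /r powRrM.
  have two : 2 = (2 `^ (p - 1)) `^ (p - 1)^-1 :> R.
    by rewrite -powRrM divff ?gt_eqF// powRr1.
  rewrite [leLHS]two; apply: ge0_ler_powR; rewrite ?nnegrE ?invr_ge0 ?powR_ge0 ?(ltW p10)//.
  rewrite powRB ?pnatr_eq0 ?implybT// powRr1// powRM ?(ltW e0)//.
  by rewrite ler_wpM2l ?powR_ge0// ltW.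
(* Now [2 * x * X <= 1], so a single sample suffices for the bound. *)
have m0 : (0 < m)%N.
  rewrite lt0n; apply/eqP => m0; have [A] := hm0 m0.
  by move: T hT; rewrite m0 => T hT; exact: no_sample_not_far hT.
have : (1 : R) <= m%:R by rewrite ler1n.
nra.
Qed.
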